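(* Let $X$ be a Tychonoff space and let $\mathrm{C}(X)$ be the vector lattice of all real-valued continuous functions on $X$. Then the following statements are equivalent. (i) $\mathrm{C}(X)$ is laterally complete. (ii) $\mathrm{C}(X)$ is universally complete. (iii) $X$ is an extremally disconnected P-space.
   Context: A Tychonoff space is a completely regular $\mathrm{T}_1$ topological space. $\mathrm{C}(X)$ carries the pointwise vector space operations and the pointwise order. Two elements $u,v$ of a vector lattice $L$ are disjoint if $|u|\wedge|v|=0$. A vector lattice $L$ is laterally complete if every nonempty set of mutually disjoint elements of its positive cone $L^+$ has a supremum in $L$. It is Dedekind complete if every nonempty subset that is bounded above has a supremum in $L$. It is universally complete if it is both Dedekind complete and laterally complete. $X$ is extremally disconnected if the closure of every open set is open. $X$ is a P-space if the intersection of countably many open sets in $X$ is open. *)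

(* Defs.v *)
From HB Require Import structures.
From mathcomp Require Import all_boot all_order all_algebra.
From mathcomp Require Import all_classical all_reals all_analysis.

Set Implicit Arguments.
Unset Strict Implicit.
Unset Printing Implicit Defensive.

Import Order.TTheory GRing.Theory Num.Theory.
Import numFieldNormedType.Exports.

Local Open Scope classical_set_scope.
Local Open Scope ring_scope.

HB.mixin Record isVectorLattice (R : numDomainType) V
    of Num.POrderedZmodule V & GRing.Lmodule R V := {
  vlat_leD2r : forall z x y : V, x <= y -> x + z <= y + z;
  vlat_scale_ge0 : forall (a : R) (x : V), 0 <= a -> 0 <= x -> 0 <= a *: x;
  vmeet : V -> V -> V;
  vjoin : V -> V -> V;
  le_vmeet : forall x y z : V, (z <= vmeet x y) = (z <= x) && (z <= y);
  vjoin_le : forall x y z : V, (vjoin x y <= z) = (x <= z) && (y <= z);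
}.

(* [vmeet] and [vjoin] are not the operations of [Order.Lattice]: no structure
   below [realDomainType] joins lattices and additive groups, so HB rejects
   such a join declared here. *)
#[short(type="vectorLatticeType")]
HB.structure Definition VectorLattice (R : numDomainType) :=
  { V of Num.POrderedZmodule V & GRing.Lmodule R V & isVectorLattice R V }.

Section vector_lattice_notions.
Context {R : numDomainType} (L : vectorLatticeType R).
Implicit Types (u v : L) (A : set L).

Definition vlat_abs u : L := vjoin u (- u).

Definition vlat_disjoint u v := vmeet (vlat_abs u) (vlat_abs v) = 0.

Definition laterally_complete := forall A,
  A !=set0 -> (forall u, A u -> 0 <= u) ->
  (forall u v, A u -> A v -> u <> v -> vlat_disjoint u v) ->
  exists s : L, isLub A s.

Definition dedekind_complete := forall A,
  A !=set0 -> has_ubound A -> exists s : L, isLub A s.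

Definition universally_complete := dedekind_complete /\ laterally_complete.

End vector_lattice_notions.

Section spaces.
Variable X : topologicalType.

(* [completely_regular_space] separates points from closed sets by a uniformity;
   by [uniform_separatorP] this is separation by a continuous function into
   [0, 1]. *)
Definition tychonoff_space := completely_regular_space X /\ accessible_space X.

Definition extremally_disconnected :=
  forall U : set X, open U -> open (closure U).

Definition P_space :=
  forall U : (set X)^nat, (forall n, open (U n)) -> open (\bigcap_n U n).

End spaces.

(* [continuousType X R] is made a subtype of [X -> R], and its operations and
   order are those of [X -> R], which are pointwise. *)
Section continuous_functions.
Context {X : topologicalType} {R : realType}.

Definition continuous_pred : {pred X -> R} :=
  mem [set f : X -> R | continuous f].

Notation C := (continuousType X R).

Let C_Sub (f : X -> R) (fP : f \in continuous_pred) : C := mkcts (set_mem fP).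

Let C_rect (K : C -> Type) :
  (forall f (fP : f \in continuous_pred), K (C_Sub fP)) -> forall u : C, K u.
Proof.
move=> KSub u; have uP : (u : X -> R) \in continuous_pred.
  by apply/mem_set; exact: cts_fun.
by have -> : u = C_Sub uP by apply/continuousEP.
Qed.

Let C_SubK (f : X -> R) (fP : f \in continuous_pred) : C_Sub fP = f :> (X -> R).
Proof. by []. Qed.

HB.instance Definition _ := isSub.Build (X -> R) _ C C_rect C_SubK.

Let submodC : submod_closed continuous_pred.
Proof.
split=> [|a f g].
  by apply/mem_set => x; exact: cvg_cst.
move=> /set_mem cf /set_mem cg; apply/mem_set => x.
apply: (@cvgD _ R^o); last exact: cg.
by apply: (@cvgZr _ R^o); exact: cf.
Qed.

HB.instance Definition _ := GRing.isSubmodClosed.Build _ _ continuous_pred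
  submodC.

HB.instance Definition _ := [SubChoice_isSubLmodule of C by <:].

HB.instance Definition _ :=
  [SubChoice_isSubPOrder of C by <: with ring_display].

Lemma continuous_leP (f g : C) : reflect (forall x, f x <= g x) (f <= g).
Proof. exact: lefP. Qed.

Let C_leD2r (h f g : C) : f <= g -> f + h <= g + h.
Proof.
move=> /continuous_leP fg; apply/continuous_leP => x.
exact: lerD (fg x) (lexx (h x)).
Qed.

Let C_scale_ge0 (a : R) (f : C) : 0 <= a -> 0 <= f -> 0 <= a *: f.
Proof.
move=> a0 /continuous_leP f0; apply/continuous_leP => x.
by apply: mulr_ge0 => //; exact: f0.
Qed.

Let min_cts (f g : C) : continuous (f \min g).
Proof. by move=> x; apply: continuous_min; exact: cts_fun. Qed.

Let max_cts (f g : C) : continuous (f \max g).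
Proof. by move=> x; apply: continuous_max; exact: cts_fun. Qed.

Let C_meet (f g : C) : C := mkcts (@min_cts f g).
Let C_join (f g : C) : C := mkcts (@max_cts f g).

Let C_le_meet (f g h : C) : (h <= C_meet f g) = (h <= f) && (h <= g).
Proof.
apply/continuous_leP/andP => [hfg|[/continuous_leP hf /continuous_leP hg] x].
  by split; apply/continuous_leP => x; have := hfg x; rewrite /= le_min => /andP[].
by rewrite /= le_min hf hg.
Qed.

Let C_join_le (f g h : C) : (C_join f g <= h) = (f <= h) && (g <= h).
Proof.
apply/continuous_leP/andP => [fgh|[/continuous_leP fh /continuous_leP gh] x].
  by split; apply/continuous_leP => x; have := fgh x; rewrite /= ge_max => /andP[].
by rewrite /= ge_max fh gh.
Qed.

HB.instance Definition _ := isVectorLattice.Build R C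
  C_leD2r C_scale_ge0 C_le_meet C_join_le.

Lemma continuous_addE (f g : C) x : (f + g) x = f x + g x.
Proof. by []. Qed.

Lemma continuous_scaleE (a : R) (f : C) x : (a *: f) x = a * f x.
Proof. by []. Qed.

Lemma continuous_meetE (f g : C) x : vmeet f g x = Num.min (f x) (g x).
Proof. by []. Qed.

Lemma continuous_joinE (f g : C) x : vjoin f g x = Num.max (f x) (g x).
Proof. by []. Qed.

Lemma continuous_absE (f : C) x : vlat_abs f x = `|f x|.
Proof. by rewrite continuous_joinE maxrN. Qed.

End continuous_functions.

(* Main.v *)
Require Import Defs.
From mathcomp Require Import all_boot all_order all_algebra.
From mathcomp Require Import all_classical all_reals all_analysis.
From mathcomp Require Import lra.
Import numFieldNormedType.Exports.

Set Implicit Arguments.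
Unset Strict Implicit.
Unset Printing Implicit Defensive.

Import Order.TTheory GRing.Theory Num.Theory.

Local Open Scope classical_set_scope.
Local Open Scope ring_scope.

(** The equivalence turns on two translations between suprema in [C(X)] and the
    topology of [X].

    From topology to order.  In an extremally disconnected space every nonempty
    family of continuous functions that is locally bounded above has a supremum
    ([extremally_disconnected_sup]): the closures of the open sets where some
    member exceeds [r] are clopen, and each of them lies between the sets where
    [s > r] and where [s >= r] for one continuous function [s].  A family with
    an upper bound in [C(X)] is locally bounded above; so [C(X)] is Dedekind
    complete.  A disjoint family is locally bounded above at least on a dense
    set, and in an extremally disconnected P-space this forces local boundedness
    everywhere ([P_space_dense_bounded_above]); so [C(X)] is laterally complete.

    From order to topology.  If [C(X)] is laterally complete, then a disjoint
    sequence of nonnegative functions is locally bounded, however large each of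
    its terms is ([lateral_seq_locally_bounded]).  Tall tents, placed along the
    values of a continuous [f >= 0] so that they accumulate at the value 0, then
    show that a zero of [f] cannot be a limit of points where [f > 0]: zero
    sets are open ([lateral_zero_near]).  By complete regularity the clopen
    sets form a base.  The same boundedness principle, applied to multiples of
    indicators of the differences of a decreasing sequence of clopen sets, makes
    countable intersections of open sets open.  Finally the supremum of the
    indicators of a maximal disjoint family of clopen subsets of an open set [U]
    is positive exactly on the closure of [U], which is therefore open. *)

Section continuous_function_lattice.
Context {R : realType} {X : topologicalType}.

Notation C := (continuousType X R).

(** * Pointwise descriptions and clopen gluing *)

Lemma open_superlevel (u : C) (r : R) : open [set x | r < u x].
Proof. have /continuousP cu := @cts_fun _ _ u; exact: (cu _ (@open_gt _ r)). Qed.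

Lemma open_sublevel (u : C) (r : R) : open [set x | u x < r].
Proof. have /continuousP cu := @cts_fun _ _ u; exact: (cu _ (@open_lt _ r)). Qed.

Lemma continuous_isLubP (A : set C) (s : C) :
  isLub A s <->
  (forall u, A u -> forall x, u x <= s x) /\
  (forall h : C, (forall u, A u -> forall x, u x <= h x) ->
                 forall x, s x <= h x).
Proof.
split=> -[ubs leasts]; split.
- by move=> u /ubs /continuous_leP.
- by move=> h ubh; apply/continuous_leP/leasts => u /ubh /continuous_leP.
- by move=> u /ubs us; apply/continuous_leP.
- move=> h ubh; apply/continuous_leP/leasts => u /ubh.
  by move=> /continuous_leP.
Qed.

Lemma vlat_disjointP (u v : C) :
  vlat_disjoint u v <-> forall x, u x = 0 \/ v x = 0.
Proof.
have minE x : vmeet (vlat_abs u) (vlat_abs v) x = Num.min `|u x| `|v x|.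
  by rewrite continuous_meetE !continuous_absE.
split=> [duv x|uv].
  have := minE x; rewrite duv -[LHS]/(0 : R) => /esym/eqP.
  by rewrite minEle; case: ifP => _; rewrite normr_eq0 => /eqP; [left|right].
apply/continuousEP => x; rewrite minE -[RHS]/(0 : R).
by case: (uv x) => ->; rewrite normr0; [apply/min_idPl|apply/min_idPr].
Qed.

Lemma patch_clopen_continuous (f g : X -> R) (K : set X) :
  clopen K -> continuous f -> continuous g -> continuous (patch f K g).
Proof.
move=> [oK cK] cf cg x; have [xK|xK] := pselect (K x).
  rewrite /continuous_at; have -> : patch f K g x = g x by rewrite /patch mem_set.
  apply: cvg_trans (cg x); apply: near_eq_cvg.
  by apply: filterS (open_nbhs_nbhs (conj oK xK)) => y Ky; rewrite /patch mem_set.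
rewrite /continuous_at; have -> : patch f K g x = f x by rewrite /patch memNset.
apply: cvg_trans (cf x); apply: near_eq_cvg.
have oCK : open (~` K) by rewrite openC.
by apply: filterS (open_nbhs_nbhs (conj oCK xK)) => y Ky; rewrite /patch memNset.
Qed.

Definition cst_cts (c : R) : C := mkcts (@cst_continuous X R c).

Definition patch_cts (f g : C) (K : set X) (cK : clopen K) : C :=
  mkcts (patch_clopen_continuous cK (@cts_fun _ _ f) (@cts_fun _ _ g)).

Lemma patch_cts_in f g K (cK : clopen K) x : K x -> patch_cts f g cK x = g x.
Proof. by move=> Kx; rewrite -[LHS]/(patch f K g x) /patch mem_set. Qed.

Lemma patch_cts_out f g K (cK : clopen K) x : ~ K x -> patch_cts f g cK x = f x.
Proof. by move=> Kx; rewrite -[LHS]/(patch f K g x) /patch memNset. Qed.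

(** * Suprema of locally bounded families *)

Definition bounded_above_near (A : set C) (x : X) :=
  exists M, \forall y \near x, forall u, A u -> u y <= M.

(** The supremum is built from its superlevel sets: [G r], the closure of the
    open set where some member of [A] exceeds [r], is open as well as closed,
    and [s x] is the supremum of the [r] with [x] in [G r].  Openness of [G r]
    gives lower semicontinuity of [s], closedness upper semicontinuity; and any
    continuous upper bound is at least [r] on [G r], so it dominates [s]. *)
Lemma extremally_disconnected_sup (A : set C) :
  extremally_disconnected X -> A !=set0 ->
  (forall x, bounded_above_near A x) -> exists s : C, isLub A s.
Proof.
move=> edX [u0 Au0] Abnd.
pose G r := closure (\bigcup_(u in A) [set x | r < u x]).
have oG r : open (G r).
  by apply: edX; apply: bigcup_open => u _; exact: open_superlevel.
pose E x : set R := [set r | G r x].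
have subG u x r : A u -> r < u x -> G r x.
  by move=> Au rux; apply: subset_closure; exists u.
have E0 x : E x !=set0.
  by exists (u0 x - 1); apply: (subG u0) => //; rewrite ltrBlDr ltrDl.
have Eub x M : (\forall y \near x, forall u, A u -> u y <= M) -> ubound (E x) M.
  move=> xM r /(_ _ xM)[y [[u Au /= ruy] uM]].
  exact: le_trans (ltW ruy) (uM u Au).
have Esup x : has_sup (E x).
  by split=> //; have [M /Eub] := Abnd x; exists M.
pose s x := sup (E x).
have s_ge x r : G r x -> r <= s x by move=> Gr; exact: (sup_upper_bound (Esup x)).
have s_gt x r : r < s x -> exists2 r', r < r' & G r' x.
  move=> rs; apply: contrapT => nr; suff : s x <= r by rewrite leNgt rs.
  apply: ge_sup => // r' Gr'; rewrite leNgt; apply/negP => rr'.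
  by apply: nr; exists r'.
have cs : continuous s.
  move=> x; apply/cvgrPdist_lt => e e0.
  have [r lr Gr] : exists2 r', s x - e < r' & G r' x.
    by apply: s_gt; rewrite ltrBlDr ltrDl.
  have nG : ~ G (s x + e / 2) x.
    by move=> /s_ge; rewrite leNgt ltrDl divr_gt0.
  have oCG : open (~` G (s x + e / 2)) by rewrite openC; exact: closed_closure.
  near=> y; rewrite distrC ltr_distl; apply/andP; split.
    apply: (lt_le_trans lr); apply: s_ge; near: y.
    exact: open_nbhs_nbhs (conj (oG r) Gr).
  apply: (@le_lt_trans _ _ (s x + e / 2)); last first.
    by rewrite ltrD2l ltr_pdivrMr// mulr_natr mulr2n ltrDl.
  have nGy : ~ G (s x + e / 2) y.
    by near: y; exact: open_nbhs_nbhs (conj oCG nG).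
  rewrite leNgt; apply/negP => /s_gt[r' lr' Gr'].
  apply: nGy; move: Gr'; apply: closureS => z [u Au /= ruz].
  by exists u => //=; exact: lt_trans ruz.
exists (mkcts cs); apply/continuous_isLubP; split=> [u Au x|h hub x] /=.
  rewrite leNgt; apply/negP => sux; have [sm mu] := midf_lt sux.
  by have /s_ge := subG u x _ Au mu; rewrite leNgt sm.
apply: ge_sup => // r Gr; rewrite leNgt; apply/negP => hxr.
have [y [[u Au /= ruy] /= hyr]] :=
  Gr _ (open_nbhs_nbhs (conj (open_sublevel h r) hxr)).
by have := lt_trans hyr ruy; rewrite ltNge hub.
Unshelve. all: by end_near. Qed.

(** Let [V n] be the interior of the set where all of [A] is at most [n].  A
    point outside every [closure (V n)] would lie in a countable intersection of
    open sets, which is open in a P-space, misses every [V n], and so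
    contradicts density.  Each point thus lies in some [closure (V n)], which is
    open, and the bound [n] passes from [V n] to its closure. *)
Lemma P_space_dense_bounded_above (A : set C) :
  extremally_disconnected X -> P_space X ->
  dense [set x | bounded_above_near A x] -> forall x, bounded_above_near A x.
Proof.
move=> edX pX dA x.
pose V (n : nat) := interior [set y | forall u, A u -> u y <= n%:R].
have oCV n : open (~` closure (V n)) by rewrite openC; exact: closed_closure.
have [[n Vnx]|nV] := pselect (exists n, closure (V n) x); last first.
  have Bx : (\bigcap_n ~` closure (V n)) x by move=> n _ Vn; apply: nV; exists n.
  have [z [Bz [M zM]]] := dA _ (ex_intro _ x Bx) (pX _ oCV).
  case: (Bz (Num.trunc M).+1 I); apply: subset_closure.
  apply: filterS zM => y yM u Au.
  exact: le_trans (yM u Au) (ltW (truncnS_gt M)).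
exists n%:R; have oVn := edX (V n) (open_interior _).
apply: filterS (open_nbhs_nbhs (conj oVn Vnx)) => y Vny u Au.
rewrite leNgt; apply/negP => nuy.
have [z [/interior_subset /(_ u Au) + /=]] :=
  Vny _ (open_nbhs_nbhs (conj (open_superlevel u n%:R) nuy)).
by rewrite leNgt => /negP.
Qed.

(** Near a point where a member of a disjoint family is positive, that member
    is the only nonzero one; on an open set without such points, all members
    vanish. *)
Lemma disjoint_dense_bounded_above (A : set C) :
  (forall u, A u -> 0 <= u) ->
  (forall u v, A u -> A v -> u <> v -> vlat_disjoint u v) ->
  dense [set x | bounded_above_near A x].
Proof.
move=> A0 dA W [w Ww] oW.
have [[u [y [Au Wy uy]]]|Wz] :=
  pselect (exists u : C, exists y, [/\ A u, W y & 0 < u y]); last first.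
  exists w; split=> //; exists 0.
  apply: filterS (open_nbhs_nbhs (conj oW Ww)) => y Wy u Au.
  by rewrite leNgt; apply/negP => uy; apply: Wz; exists u, y.
exists y; split=> //; exists (u y + 1).
have uy1 : u y < u y + 1 by rewrite ltrDl.
apply: filterS (filterI (open_nbhs_nbhs (conj (open_superlevel u 0) uy))
                        (open_nbhs_nbhs (conj (open_sublevel u _) uy1))).
move=> z [/= uz uzM] v Av.
have [->|/eqP uv] := eqVneq v u; first exact: ltW.
have /vlat_disjointP/(_ z)[->|uz0] := dA _ _ Av Au uv.
  by rewrite addr_ge0 ?ltW.
by rewrite uz0 ltxx in uz.
Qed.

Lemma P_extremally_disconnected_universally_complete :
  extremally_disconnected X -> P_space X -> universally_complete C.
Proof.
move=> edX pX; split=> A A0.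
  move=> [h hub]; apply: extremally_disconnected_sup => // x.
  exists (h x + 1); have hx : h x < h x + 1 by rewrite ltrDl.
  apply: filterS (open_nbhs_nbhs (conj (open_sublevel h _) hx)) => y hy u Au.
  apply: le_trans (ltW hy); exact: (continuous_leP _ _ (hub _ Au)).
move=> Age0 dA; apply: extremally_disconnected_sup => //.
by apply: P_space_dense_bounded_above => //; exact: disjoint_dense_bounded_above.
Qed.

(** * Openness of zero sets *)

(** An upper bound of the sequence is a continuous function, and a continuous
    function is locally bounded. *)
Lemma lateral_seq_locally_bounded (g : nat -> C) :
  laterally_complete C -> (forall n x, 0 <= g n x) ->
  (forall n m x, n != m -> g n x = 0 \/ g m x = 0) ->
  forall x : X, exists N : nat, \forall y \near x, forall n, g n y < N%:R.
Proof.
move=> lat g0 gd x.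
have [s /continuous_isLubP[sub _]] : exists s : C, isLub (range g) s.
  apply: lat; first by exists (g 0%N), 0%N.
    by move=> _ [n _ <-]; apply/continuous_leP; exact: g0.
  move=> _ _ [n _ <-] [m _ <-] nm; apply/vlat_disjointP => y; apply: gd.
  by apply/eqP => E; apply: nm; rewrite E.
exists (Num.trunc (s x)).+1.
have sx := truncnS_gt (s x).
apply: filterS (open_nbhs_nbhs (conj (open_sublevel s _) sx)) => y sy n.
by apply: le_lt_trans sy; apply: sub; exists n.
Qed.

(** Where [f > 0] this is [m ^ 2 * f] times the tent of height 1 and half-width
    1 centred at [m], evaluated at [1 / f].  The factor [f] makes it extend
    continuously by 0 to the zeros of [f]; since [f] is about [1 / m] on the
    support, the factor [m ^ 2] leaves a height of order [m]. *)
Definition tent (f : C) (m : nat) : C :=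
  m%:R ^+ 2 *: vjoin 0 (f - vlat_abs (cst_cts 1 - m%:R *: f)).

Lemma tentE (f : C) m x :
  tent f m x = m%:R ^+ 2 * Num.max 0 (f x - `|1 - m%:R * f x|).
Proof.
rewrite /tent continuous_scaleE continuous_joinE.
by rewrite -[in RHS](continuous_absE (cst_cts 1 - m%:R *: f)).
Qed.

Lemma tent_ge0 (f : C) m x : 0 <= tent f m x.
Proof. by rewrite tentE mulr_ge0 ?sqr_ge0// le_max lexx. Qed.

Lemma tent_disjoint (f : C) m n x :
  (m.+1 < n)%N -> tent f m x = 0 \/ tent f n x = 0.
Proof.
move=> mn; rewrite !tentE.
have mnR : m%:R + 2 <= n%:R :> R by rewrite -natrD ler_nat addn2.
have [fm|fm] := leP (f x) `|1 - m%:R * f x|.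
  by left; rewrite (max_idPl _) ?mulr0// subr_le0.
have [fn|fn] := leP (f x) `|1 - n%:R * f x|.
  by right; rewrite (max_idPl _) ?mulr0// subr_le0.
have f0 := le_lt_trans (normr_ge0 _) fm.
exfalso; have := ler_wpM2r (ltW f0) mnR.
by move: fm fn; rewrite !ltr_norml => /andP[? ?] /andP[? ?]; lra.
Qed.

(** Take for [m] an integer within [1 / 2] of [1 / f y]: the tent of height 1
    centred at [m] is at least [1 / 2] at [1 / f y], and [f y <= 1 / 2] ensures
    that [m * f y >= 1 / 2]. *)
Lemma tent_large (f : C) (y : X) : 0 < f y -> f y <= 2^-1 ->
  exists m : nat, (f y)^-1 <= m%:R + 2^-1 /\ m%:R / 4 <= tent f m y.
Proof.
move=> f0 f2; pose t := (f y)^-1.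
have t0 : 0 <= t + 2^-1 by rewrite addr_ge0// invr_ge0 ltW.
exists (Num.trunc (t + 2^-1)); set m := Num.trunc _.
have /andP[mt tm] := truncn_itv t0; rewrite -/m in mt tm.
have ft : f y * t = 1 by rewrite mulfV ?gt_eqF.
rewrite -/t; split; first by move: tm; rewrite -[m.+1%:R]natr1; lra.
have m1 : 1 - m%:R * f y <= f y / 2.
  by have := ler_wpM2r (ltW f0) (ltW tm); rewrite -[m.+1%:R]natr1; lra.
have m2 : - (f y / 2) <= 1 - m%:R * f y.
  by have := ler_wpM2r (ltW f0) mt; lra.
have mabs : `|1 - m%:R * f y| <= f y / 2 by rewrite ler_norml m2.
rewrite tentE; apply: (@le_trans _ _ (m%:R ^+ 2 * (f y / 2))); last first.
  by rewrite ler_wpM2l ?sqr_ge0// le_max; apply/orP; right; lra.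
have m0 : 0 <= m%:R :> R by [].
have : 2^-1 <= m%:R * f y by lra.
nra.
Qed.

(** The tents with [m] even are pairwise disjoint, and so are those with [m]
    odd; hence all tents are bounded near [x] by one constant.  At a point close
    to [x] where [f] is positive but very small, some tent of large index
    exceeds that constant. *)
Lemma lateral_zero_near (f : C) :
  laterally_complete C -> (forall y, 0 <= f y) ->
  forall x, f x = 0 -> \forall y \near x, f y = 0.
Proof.
move=> lat f0 x fx0.
have bnd c : exists N : nat,
    \forall y \near x, forall n, tent f (n.*2 + c) y < N%:R.
  apply: (lateral_seq_locally_bounded (g := fun n => tent f (n.*2 + c))) => //.
    by move=> n y; exact: tent_ge0.
  move=> n m y; rewrite neq_ltn => /orP[nm|mn].
    by apply: tent_disjoint; rewrite -addSn ltn_add2r -doubleS leq_double.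
  by apply/or_comm/tent_disjoint; rewrite -addSn ltn_add2r -doubleS leq_double.
have [N0 bnd0] := bnd 0%N; have [N1 bnd1] := bnd 1%N.
(* [4 * N + 2] is chosen so that [1 / f > 4 * N + 2] yields an [m] with
   [m / 4 > N]. *)
pose N : R := N0%:R + N1%:R.
have N0R : 0 <= N0%:R :> R by []; have N1R : 0 <= N1%:R :> R by [].
have small : f x < (4 * N + 2)^-1 by rewrite fx0 invr_gt0 /N; lra.
near=> y.
apply/eqP; rewrite eq_le f0 andbT leNgt; apply/negP => fy.
have fys : f y < (4 * N + 2)^-1.
  near: y; exact: open_nbhs_nbhs (conj (open_sublevel f _) small).
have tN : 4 * N + 2 < (f y)^-1.
  by rewrite -[X in X < _]invrK ltf_pV2// posrE// invr_gt0 /N; lra.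
have [] := @tent_large f y fy.
  by rewrite (le_trans (ltW fys))// lef_pV2 ?posrE /N; lra.
move=> m [tm mt].
have mN : tent f m y < N.
  rewrite -(odd_double_half m) addnC.
  case: (odd m).
    apply: (@lt_le_trans _ _ N1%:R); last by rewrite /N; lra.
    by move: (m./2); near: y.
  apply: (@lt_le_trans _ _ N0%:R); last by rewrite /N; lra.
  by move: (m./2); near: y.
lra.
Unshelve. all: by end_near. Qed.

(** * Topology of the space when the lattice is laterally complete *)

Lemma lateral_clopen_nbhs (U : set X) (x : X) :
  completely_regular_space X -> laterally_complete C -> open U -> U x ->
  exists K, [/\ clopen K, K x & K `<=` U].
Proof.
move=> crX lat oU Ux.
have cCU : closed (~` U) by rewrite closedC.
have [f [cf f01 fx fU]] :=
  (@uniform_separatorP _ R _ _).1 (crX x _ cCU (fun nUx => nUx Ux)).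
have f0 y : 0 <= f y.
  by have /= := f01 (f y) (imageT f y); rewrite in_itv => /andP[].
have fx0 : f x = 0 by apply: fx; exists x.
exists [set y | f y = 0]; split=> //.
- split.
    rewrite openE => y fy0.
    exact: (@lateral_zero_near (mkcts cf) lat f0 y fy0).
  rewrite -openC (_ : ~` _ = [set y | 0 < mkcts cf y]).
    exact: open_superlevel.
  apply/seteqP; split=> y /=; last first.
    by move=> + fy; rewrite -[mkcts cf y]/(f y) fy ltxx.
  by move=> /eqP fy; rewrite lt_neqAle eq_sym fy f0.
- move=> y /= fy; apply: contrapT => nUy.
  have : f y = 1 by apply: fU; exists y.
  by rewrite fy => /esym/eqP; rewrite oner_eq0.
Qed.

(** Let [L n] be a decreasing sequence of clopen neighbourhoods of [x] whose
    intersection lies in that of the [U n].  The functions equal to [n + 1] on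
    [L n] minus [L n.+1] and to 0 elsewhere are disjoint, hence all less than
    some [N] near [x].  A point of [L N] near [x] therefore never leaves the
    sequence. *)
Lemma lateral_P_space :
  completely_regular_space X -> laterally_complete C -> P_space X.
Proof.
move=> crX lat U oU; rewrite openE => x Ux.
have /choice[K KP] n : exists K, [/\ clopen K, K x & K `<=` U n].
  exact: (lateral_clopen_nbhs crX lat (oU n) (Ux n I)).
have cK n : clopen (K n) by have [] := KP n.
pose L n := \big[setI/setT]_(i < n) K i.
have LS n : L n.+1 = L n `&` K n by rewrite /L big_ord_recr /=.
have cL n : clopen (L n).
  elim: n => [|n IH]; first by rewrite /L big_ord0; exact: clopenT.
  by rewrite LS; exact: clopenI.
have Lx n : L n x.
  elim: n => [|n IH]; first by rewrite /L big_ord0.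
  by rewrite LS; split=> //; case: (KP n).
have cD n : clopen (L n `\` K n).
  by rewrite setDE; apply: clopenI => //; exact: (@clopenC _ _ set0).
pose g n := patch_cts (cst_cts 0) (cst_cts n.+1%:R) (cD n).
have g_in n y : L n y -> ~ K n y -> g n y = n.+1%:R.
  by move=> Ly Ky; rewrite /g patch_cts_in.
have g_out n y : ~ (L n `\` K n) y -> g n y = 0.
  by move=> nD; rewrite /g patch_cts_out.
have L_sub n m : (n <= m)%N -> L m `<=` L n.
  elim: m => [|m IH]; first by rewrite leqn0 => /eqP ->.
  by rewrite leq_eqVlt => /orP[/eqP -> //|/IH Lmn]; rewrite LS => y [/Lmn].
have [N gN] : exists N : nat, \forall y \near x, forall n, g n y < N%:R.
  apply: lateral_seq_locally_bounded => //.
    move=> n y; have [[Ln Kn]|nD] := pselect ((L n `\` K n) y).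
      by rewrite g_in.
    by rewrite g_out.
  have gd n m y : (n < m)%N -> g n y = 0 \/ g m y = 0.
    move=> nm; have [Lm|Lm] := pselect (L m y); last first.
      by right; apply: g_out => -[].
    by left; apply: g_out => -[_]; have := L_sub _ _ nm y Lm; rewrite LS => -[].
  by move=> n m y; rewrite neq_ltn => /orP[/gd //|/gd] /(_ y)/or_comm.
apply: filterS (filterI gN (open_nbhs_nbhs (conj (cL N).1 (Lx N)))).
move=> y [yN Ly] n _.
have LNk k : L (N + k)%N y.
  elim: k => [|k IH]; first by rewrite addn0.
  rewrite addnS LS; split=> //; apply: contrapT => nK.
  by have := yN (N + k)%N; rewrite g_in// ltr_nat ltnNge -addnS leq_addr.
have [_ _] := KP n; apply.
by have := L_sub n.+1 (N + n.+1)%N (leq_addl _ _) y (LNk _); rewrite LS => -[].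
Qed.

(** Let [s] be the supremum of the indicators of a maximal disjoint family of
    clopen subsets of [U].  By maximality there is no room in [U] for the open
    set where [s < 1], so [s >= 1] on [U] and [s > 0] on its closure.  Off the
    closure, [s] may be replaced by 0 on a clopen set disjoint from [U] and
    remains an upper bound, so [s <= 0] there. *)
Lemma lateral_extremally_disconnected :
  completely_regular_space X -> laterally_complete C ->
  extremally_disconnected X.
Proof.
move=> crX lat U oU.
have [E [ED tE maxE]] := @ex_maximal_disjoint_subcollection _ X id
  [set K | clopen K /\ K `<=` U].
(* The zero function, the indicator of the empty set, makes [A] nonempty. *)
pose A : set C := [set u | (forall x, u x = 0) \/
                           exists2 K, E K & forall x, u x = \1_K x].
have [s /continuous_isLubP[sub sleast]] : exists s, isLub A s.
  apply: lat; first by exists (cst_cts 0); left.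
    move=> u Au; apply/continuous_leP => x; rewrite -[X in X <= _]/(0 : R).
    by case: Au => [->//|[K _ ->]]; rewrite indicE.
  move=> u v Au Av uv; apply/vlat_disjointP => x.
  case: Au => [->|[K EK uK]]; first by left.
  case: Av => [->|[K' EK' vK]]; first by right.
  rewrite uK vK !indicE.
  have [xK|xK] := boolP (x \in K); last by left.
  have [xK'|xK'] := boolP (x \in K'); last by right.
  case: uv; apply/continuousEP => y; rewrite uK vK.
  by rewrite (tE _ _ EK EK')//; exists x; split; exact: set_mem.
have s1 K x : E K -> K x -> 1 <= s x.
  move=> EK Kx; have [cK _] := ED _ EK.
  have := sub (patch_cts (cst_cts 0) (cst_cts 1) cK) _ x.
  rewrite patch_cts_in//; apply; right; exists K => // y; rewrite indicE.
  have [Ky|nKy] := pselect (K y); first by rewrite patch_cts_in// mem_set.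
  by rewrite patch_cts_out// memNset.
have sU x : U x -> 1 <= s x.
  move=> Ux; rewrite leNgt; apply/negP => sx.
  have oW : open (U `&` [set y | s y < 1]).
    by apply: openI => //; exact: open_sublevel.
  have [K [cK Kx KW]] := lateral_clopen_nbhs crX lat oW (conj Ux sx).
  have nEK K' z : E K' -> K' z -> K z -> False.
    by move=> EK' K'z /KW[_ /=]; rewrite ltNge (s1 K').
  apply: (maxE (K |` E)).
  - split=> [K'|/(_ K)]; first by right.
    by move=> /(_ (or_introl erefl)) EK; exact: (nEK K x).
  - by move=> K' [->|/ED//]; split=> // y /KW[].
  - move=> K1 K2 [->|E1] [->|E2] // [z [z1 z2]].
    + by case: (nEK K2 z).
    + by case: (nEK K1 z).
    + by apply: tE => //; exists z.
have s0 x : ~ closure U x -> s x <= 0.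
  move=> nx; have oCU : open (~` closure U).
    by rewrite openC; exact: closed_closure.
  have [K [cK Kx KU]] := lateral_clopen_nbhs crX lat oCU nx.
  have := sleast (patch_cts s (cst_cts 0) cK) _ x; rewrite patch_cts_in//; apply.
  move=> u Au y; have [Ky|nKy] := pselect (K y).
    rewrite patch_cts_in//; case: Au => [->//|[K' /ED[_ K'U] ->]].
    rewrite indicE memNset// => /K'U/(@subset_closure _ U); exact: KU.
  by rewrite patch_cts_out//; exact: sub.
rewrite (_ : closure U = [set x | 0 < s x]); first exact: open_superlevel.
apply/seteqP; split=> x /=.
  move=> Ux; rewrite ltNge; apply/negP => sx.
  have sx1 := le_lt_trans sx ltr01.
  have [y [/sU + /=]] := Ux _ (open_nbhs_nbhs (conj (open_sublevel s 1) sx1)).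
  by rewrite leNgt => /negP.
by move=> sx; apply: contrapT => /s0; rewrite leNgt sx.
Qed.

End continuous_function_lattice.

Theorem corollary3p2 (R : realType) (X : topologicalType) :
  tychonoff_space X ->
  [<-> laterally_complete (continuousType X R);
       universally_complete (continuousType X R);
       extremally_disconnected X /\ P_space X].
Proof.
move=> [crX _].
have lat_top : laterally_complete (continuousType X R) ->
    extremally_disconnected X /\ P_space X.
  by move=> lat; split;
    [exact: lateral_extremally_disconnected lat|exact: lateral_P_space lat].
tfae.
- by move=> /lat_top[]; exact: P_extremally_disconnected_universally_complete.
- by move=> [_ /lat_top].
- by move=> [ed p];
    have [] := @P_extremally_disconnected_universally_complete R X ed p.
Qed.
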